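(* Let $\varepsilon>0$ and let $k\geq 1$ and $d\geq 2$ be fixed integers. Then there exist positive constants $c_1$ and $c_2$ depending only on $d$, $k$ and $\varepsilon$ such that for every prime $p$ the following holds. If $f_1,\ldots,f_k\in\mathbb{F}_p[X]$ are polynomials of positive degree at most $d$ and $\mathscr{C}_0\geq c_1$, then for every $u\in\mathbb{F}_p$, $$ G_k(N)\geq c_2\min\{V_u(N)^{2-\varepsilon},\, p^{1-\varepsilon}\}\qquad\text{for all integers } N\geq 1 . $$
   Context: Let $p$ be a prime, $\mathbb{F}_p$ the field of $p$ elements, $\overline{\mathbb{F}}_p$ its algebraic closure, and $f_1,\ldots,f_k\in\mathbb{F}_p[X]$ polynomials of positive degree. For $u\in\mathbb{F}_p$ and an integer $N\ge 0$ put $$\mathcal{V}_u(N)=\{f_{i_1}\circ\cdots\circ f_{i_n}(u):\ i_1,\ldots,i_n\in\{1,\ldots,k\},\ 0\leq n\leq N\}$$ (the case $n=0$ gives $u$ itself), and $V_u(N)=\#\mathcal{V}_u(N)$. $G_k(N)$ (which depends also on $u$ and $f_1,\dots,f_k$) is the size of the smallest subgroup $\mathcal{G}\subseteq\mathbb{F}_p^*$ which contains all non-zero elements of $\mathcal{V}_u(N)$, i.e. $\mathcal{V}_u(N)\subseteq\mathcal{G}\cup\{0\}$. The functional graph $\mathcal{H}(\overline{\mathbb{F}}_p)$ has vertex set $\overline{\mathbb{F}}_p$ and directed edges $(x,y)$ with $f_i(x)=y$, $1\leq i\leq k$ (an edge labelled $i$ for each $x$ and each $i$). Let $\overline{\mathcal{H}}(\overline{\mathbb{F}}_p)$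 be the corresponding undirected graph obtained by forgetting orientations. $\mathscr{C}_0$ is the length of a shortest cycle in $\overline{\mathcal{H}}(\overline{\mathbb{F}}_p)$ which contains the vertex $0$, with $\mathscr{C}_0=\infty$ if there is no such cycle; a loop is a cycle of length $1$ and two distinct edges joining the same two vertices form a cycle of length $2$. (With this convention, for $k=1$, $\mathscr{C}_0$ equals the period of $0$ under iteration of $f_1$ if $0$ is periodic, and $\infty$ otherwise.) *)

(* Defs.v *)
From mathcomp Require Import all_boot all_order all_algebra all_fingroup.
From mathcomp Require Import boolp classical_sets reals ereal exp.

Set Implicit Arguments.
Unset Strict Implicit.
Unset Printing Implicit Defensive.

Import Order.TTheory GRing.Theory Num.Theory.

Local Open Scope ring_scope.

Section OrbitSets.

Variables (p k : nat) (f : 'I_k -> {poly 'F_p}) (u : 'F_p).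

(* For s = [:: i_1; ...; i_n] this is f_{i_1}(f_{i_2}(... f_{i_n}(u))). *)
Definition word_eval (s : seq 'I_k) : 'F_p := foldr (fun i y => (f i).[y]) u s.

Definition orbit_set (N : nat) : {set 'F_p} :=
  (\bigcup_(n < N.+1) [set word_eval t | t : n.-tuple 'I_k])%SET.

Definition orbit_size (N : nat) : nat := #|orbit_set N|.

(* MathComp's <<A>> is by definition the intersection of all subgroups that
   contain A, hence the smallest one. *)
Definition orbit_group (N : nat) : {set {unit 'F_p}} :=
  <<[set g : {unit 'F_p} | val g \in orbit_set N]%SET>>%g.

Definition orbit_group_size (N : nat) : nat := #|orbit_group N|.

End OrbitSets.

Section FunctionalGraph.

Variables (F : nzRingType) (K : closedFieldType) (iota : {rmorphism F -> K}).
Variables (k : nat) (f : 'I_k -> {poly F}).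

(* The pair (x, i) is the edge labelled i that leaves x, so edges that have the
   same endpoints but different labels, or opposite orientations, are distinct. *)
Definition edge : Type := (K * 'I_k)%type.

Definition edge_target (e : edge) : K := (map_poly iota (f e.2)).[e.1].

Definition joins (e : edge) (x y : K) : Prop :=
  (e.1 = x /\ edge_target e = y) \/ (e.1 = y /\ edge_target e = x).

(* [ordS j] is j + 1 modulo n.  Distinctness of the edges follows from that of
   the vertices for n <> 2; for n = 2 it prevents traversing one edge twice. *)
Definition is_cycle (n : nat) (v : 'I_n -> K) (e : 'I_n -> edge) : Prop :=
  [/\ (0 < n)%N, injective v, injective e &
      forall j : 'I_n, joins (e j) (v j) (v (ordS j))].

Definition cycle_length_at (x : K) (n : nat) : Prop :=
  exists (v : 'I_n -> K) (e : 'I_n -> edge),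
    is_cycle v e /\ exists j : 'I_n, v j = x.

(* The infimum of the empty set is +oo. *)
Definition shortest_cycle_at (R : realType) (x : K) : \bar R :=
  ereal_inf [set (n%:R)%:E | n in cycle_length_at x]%classic.

End FunctionalGraph.

(* Main.v *)
(* Stepanov's method with several polynomials.  Write G for the group, t for its
   order, and w_i for the i-th iterate of f_1, 0 <= i < m, with m large in terms
   of eps.  If x lies in V_u(N - m), then every w_i(x) lies in G or vanishes, so
   it is enough to bound the number of x with all w_i(x) in G by a constant times
   t^(1/2 + 1/m).  A common root of w_i and w_j would make 0 periodic under f_1
   with a short period, which yields a short cycle through 0 in the functional
   graph; hence the w_i are pairwise coprime.

   With B of order t^(1/(2m)), put h_b = prod_i w_i^(t b_i) for 0 <= b_i < B; all
   h_b equal 1 at the points to be counted.  The derivation D F = g F', where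
   g = prod_i w_i, maps P h_b to Q h_b with Q of controlled degree, so linear
   algebra gives Psi = sum_b P_b h_b, with small P_b not all zero, that vanishes
   to order M = B^(m-1) at these points.  Comparison with deg Psi gives the bound,
   provided that Psi <> 0, i.e. that the h_b are independent over polynomials of
   small degree.  This is shown by adding the w_i one at a time: in a relation,
   the coefficient of the lowest power of the last w_i is divisible by w_i^t,
   whereas a Wronskian argument bounds its order of vanishing at a root of w_i. *)

Require Import Defs.
From mathcomp Require Import all_boot all_order all_algebra all_fingroup.
From mathcomp Require Import cyclic.
From mathcomp Require Import boolp classical_sets reals ereal exp.
From mathcomp Require Import zify ring lra.

Set Implicit Arguments.
Unset Strict Implicit.
Unset Printing Implicit Defensive.

Import Order.TTheory GRing.Theory Num.Theory.

Local Open Scope ring_scope.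

(** * Linear algebra and top coefficients of products *)

Lemma underdetermined_system (K : fieldType) (I L : finType) (c : I -> L -> K) :
  (#|L| < #|I|)%N ->
  exists lam : I -> K,
    (exists i, lam i != 0) /\ forall l, \sum_i lam i * c i l = 0.
Proof.
move=> ltLI.
pose A := \matrix_(i < #|I|, l < #|L|) c (enum_val i) (enum_val l).
have: kermx A != 0.
  by rewrite kermx_eq0 -row_leq_rank -ltnNge (leq_ltn_trans (rank_leq_col A)).
move=> /rowV0Pn[v /sub_kermxP vA /rV0Pn[j vj]].
exists (fun i => v 0 (enum_rank i)); split.
  by exists (enum_val j); rewrite enum_valK.
move=> l; have /matrixP/(_ 0 (enum_rank l)) := vA; rewrite !mxE => vA0.
rewrite -[RHS]vA0 (reindex (@enum_val _ (mem I))) /=; last first.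
  by exists enum_rank => i _; rewrite (enum_valK, enum_rankK).
by apply: eq_bigr => i _; rewrite !mxE enum_valK enum_rankK.
Qed.

Lemma size_mul_leS (K : nzRingType) (a b : nat) (P Q : {poly K}) :
  (size P <= a.+1)%N -> (size Q <= b.+1)%N -> (size (P * Q)%R <= (a + b).+1)%N.
Proof. by move=> sP sQ; apply: leq_trans (size_polyMleq _ _) _; lia. Qed.

Lemma coef_mul_top (K : nzRingType) (a b : nat) (P Q : {poly K}) :
  (size P <= a.+1)%N -> (size Q <= b.+1)%N -> (P * Q)`_(a + b) = P`_a * Q`_b.
Proof.
move=> sP sQ; have lta : (a < (a + b).+1)%N by rewrite ltnS leq_addr.
rewrite coefM (bigD1 (Ordinal lta)) //= addKn big1 ?addr0 // => i.
rewrite -val_eqE /= => neq_ia.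
have [lt_ia|le_ai] := ltnP i a.
  by rewrite [X in _ * X]nth_default ?mulr0 // (leq_trans sQ) // ltn_subRL ltn_add2r.
by rewrite [X in X * _]nth_default ?mul0r // (leq_trans sP) // ltn_neqAle eq_sym neq_ia.
Qed.

(** * The derivation g F' and its effect on divisibility and degree *)

Definition derg (K : fieldType) (g F : {poly K}) := g * F^`().

Lemma derg_sum (K : fieldType) (g : {poly K}) n (I : finType) (c : I -> K)
    (F : I -> {poly K}) :
  iter n (derg g) (\sum_i c i *: F i) = \sum_i c i *: iter n (derg g) (F i).
Proof.
elim: n => //= n ->; rewrite /derg raddf_sum mulr_sumr /=.
by apply: eq_bigr => i _; rewrite derivZ scalerAr.
Qed.

(** Since g h'/h is a polynomial, g (Q h)' = (g Q' + Q g h'/h) h. *)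
Lemma dvd_derg_mul (K : fieldType) (g h P : {poly K}) :
  h %| g * h^`() -> h %| P -> h %| derg g P.
Proof.
move=> hh /dvdpP[Q ->]; rewrite /derg derivM mulrDr.
apply: dvdp_add; first by rewrite mulrA dvdp_mull.
by rewrite mulrCA dvdp_mull.
Qed.

Lemma dvd_iter_derg (K : fieldType) (g h P : {poly K}) n :
  h %| g * h^`() -> h %| P -> h %| iter n (derg g) P.
Proof. by move=> hh hP; elim: n => //= n; apply: dvd_derg_mul. Qed.

(** The factor X is the iterate [w 0]. It makes X F' keep the degree bound and multiply the
    coefficient in degree d by d, so [derg] acts on top coefficients by scalars. *)
Lemma derg_top (K : fieldType) (g0 F : {poly K}) d :
  (size F <= d.+1)%N ->
  (size (derg ('X * g0)%R F) <= (d + (size g0).-1).+1)%N /\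
  (derg ('X * g0) F)`_(d + (size g0).-1) = lead_coef g0 * d%:R * F`_d.
Proof.
move=> sF; rewrite /derg mulrAC.
have sXF : (size ('X * F^`())%R <= d.+1)%N.
  apply/leq_sizeP => -[|j] hj; rewrite coefXM //= coef_deriv nth_default ?mul0rn //.
  by apply: leq_trans sF _.
have sg : (size g0 <= (size g0).-1.+1)%N by rewrite leqSpred.
split.
  exact: size_mul_leS.
rewrite coef_mul_top // coefXM lead_coefE; case: d {sF sXF} => [|d] /=.
  by rewrite !(mulr0, mul0r).
by rewrite coef_deriv -mulr_natl; ring.
Qed.

(** Here [d] is only a bound for the degree, so the formula survives when a factor [d + i * D]
    vanishes in K. *)
Lemma iter_derg_top (K : fieldType) (g0 F : {poly K}) d n :
  let D := (size g0).-1 in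
  (size F <= d.+1)%N ->
  (size (iter n (derg ('X * g0)%R) F) <= (d + n * D).+1)%N /\
  (iter n (derg ('X * g0)%R) F)`_(d + n * D) =
    lead_coef g0 ^+ n * (\prod_(i < n) (d + i * D)%:R) * F`_d.
Proof.
move=> D sF; elim: n => [|n [IHs IHc]] /=.
  by rewrite mul0n addn0 big_ord0 !mul1r.
have [hs hc] := derg_top g0 IHs.
have -> : (d + n.+1 * D = d + n * D + (size g0).-1)%N by rewrite -/D; lia.
split=> //; rewrite hc IHc big_ord_recr /= exprS; ring.
Qed.

Lemma size_iter_derg (K : fieldType) (g0 F : {poly K}) n :
  (size (iter n (derg ('X * g0)%R) F) <= size F + n * (size g0).-1)%N.
Proof.
have [->|F0] := eqVneq F 0.
  suff -> : iter n (derg ('X * g0)%R) 0 = 0 by rewrite size_poly0.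
  by elim: n => //= n ->; rewrite /derg deriv0 mulr0.
have sF : (size F <= (size F).-1.+1)%N by rewrite leqSpred.
have [hs _] := iter_derg_top g0 n sF.
by rewrite -size_poly_gt0 in F0; apply: leq_trans hs _; lia.
Qed.

(** * Differential operators in characteristic p *)

Lemma natr_pchar_neq0 (K : fieldType) (p n : nat) :
  p \in [pchar K] -> (0 < n < p)%N -> n%:R != 0 :> K.
Proof.
move=> charK /andP[n_gt0 ltnp]; rewrite -(dvdn_pcharf charK).
by apply/negP => /(dvdn_leq n_gt0); rewrite leqNgt ltnp.
Qed.

Lemma natr_pchar_inj (K : fieldType) (p i j : nat) :
  p \in [pchar K] -> (i < p)%N -> (j < p)%N -> i%:R = j%:R :> K -> i = j.
Proof.
move=> charK; wlog le_ij : i j / (i <= j)%N => [wlog_ij lt_ip lt_jp eq_ij|].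
  have [le_ij|/ltnW le_ji] := leqP i j; first exact: wlog_ij.
  exact/esym/wlog_ij.
move=> lt_ip lt_jp eq_ij; apply/eqP; rewrite eqn_leq le_ij leqNgt.
apply/negP => lt_ij; have dij : (0 < j - i < p)%N by lia.
by have := natr_pchar_neq0 charK dij; rewrite natrB // eq_ij subrr eqxx.
Qed.

(* The order [r] operator [sum_n a_n D^n] maps a polynomial of degree [d] with
   leading coefficient [c] to one whose coefficient in degree [e + d] is
   [q(d) c], where [q] is a nonzero polynomial of degree less than [r].  So only
   the fewer than [r] degrees [d < p] with [q(d) = 0] occur in its kernel. *)
Lemma derg_operator_kernel (K : fieldType) (p r : nat) (g0 : {poly K})
    (a F : 'I_r -> {poly K}) :
  p \in [pchar K] -> g0 != 0 -> (exists n, a n != 0) ->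
  (forall j, (size (F j) <= p)%N) ->
  (forall j, \sum_n a n * iter n (derg ('X * g0)) (F j) = 0) ->
  exists lam : 'I_r -> K, (exists j, lam j != 0) /\ \sum_j lam j *: F j = 0.
Proof.
move=> charK g0_neq0 [n0 an0] sF LF.
set D := (size g0).-1; pose l := lead_coef g0.
have l_neq0 : l != 0 by rewrite lead_coef_eq0.
(* The power of X compensates the degree growth [n * D] of n applications of [derg], so all terms of
   the operator are compared in the single degree [e + d]. *)
pose b n : {poly K} := a n * 'X^(n * D).
pose e := (\max_(n < r) size (b n)).-1.
have sb n : (size (b n) <= e.+1)%N.
  by apply: leq_trans (leqSpred _); apply: leq_bigmax.
have [n1 bn1] : exists n1, (b n1)`_e != 0.
  have r_gt0 : (0 < #|'I_r|)%N by rewrite card_ord (leq_ltn_trans _ (ltn_ord n0)).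
  have [n1 En1] := bigop.eq_bigmax (fun n : 'I_r => size (b n)) r_gt0.
  exists n1; rewrite /e En1 -lead_coefE lead_coef_eq0 -size_poly_gt0 -En1.
  apply: leq_trans (leq_bigmax n0); rewrite size_poly_gt0 mulf_neq0 //.
  by rewrite -size_poly_gt0 size_polyXn.
pose u n : {poly K} := \prod_(i < n) ('X + (i * D)%:R%:P).
have su n : size (u n) = n.+1.
  have := size_prod_XsubC (enum 'I_n) (fun i => - (i * D)%:R : K).
  rewrite size_enum_ord big_enum /= => <-.
  by congr (size (polyseq _)); apply: eq_bigr => i _; rewrite polyCN opprK.
pose q := \sum_(n < r) ((b n)`_e * l ^+ n) *: u n.
have sq : (size q <= r)%N.
  apply: leq_trans (size_sum _ _ _) _; apply/bigmax_leqP => n _.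
  by apply: leq_trans (size_scale_leq _ _) _; rewrite su.
(* The [u n] have distinct degrees, so the largest n for which [b n] has a nonzero coefficient in
   degree [e] supplies the leading term of [q]. *)
have q_neq0 : q != 0.
  have [n2 bn2 max_n2] :=
    @arg_maxnP _ n1 (fun n => (b n)`_e != 0) (fun n : 'I_r => val n) bn1.
  apply/eqP => q0; have: q`_n2 = 0 by rewrite q0 coef0.
  rewrite coef_sum (bigD1 n2) //= big1 ?addr0 => [|n neq_n].
    have un2 : (u n2)`_n2 != 0.
      have -> : (u n2)`_n2 = lead_coef (u n2) by rewrite lead_coefE su.
      by rewrite lead_coef_eq0 -size_poly_gt0 su.
    move/eqP; rewrite coefZ !mulf_eq0 (negPf bn2) (negPf un2).
    by rewrite expf_eq0 (negPf l_neq0) andbF.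
  rewrite coefZ; have [bn|/max_n2 le_n] := eqVneq (b n)`_e 0.
    by rewrite bn !mul0r.
  rewrite [X in _ * X]nth_default ?mulr0 // su ltn_neqAle.
  by rewrite -val_eqE /= in neq_n; rewrite neq_n.
pose E := [set i : 'I_p | root q i%:R].
have ltEr : (#|E| < r)%N.
  apply: leq_trans sq; rewrite cardE.
  rewrite -(size_map (fun i : 'I_p => i%:R : K)).
  apply: max_poly_roots => //.
    by apply/allP => _ /mapP[i + ->]; rewrite mem_enum inE.
  rewrite map_inj_uniq ?enum_uniq // => i j eq_ij.
  by apply/val_inj/(natr_pchar_inj charK _ _ eq_ij).
(* A combination without coefficients in the degrees of [E] must vanish, since otherwise its own
   degree would lie in [E]. *)
have [|lam [lam_neq0 lamE]] := @underdetermined_system K 'I_r {i | i \in E}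
  (fun j i => (F j)`_(val i)).
  rewrite card_sig card_ord; apply: leq_trans ltEr.
  by rewrite ltnS (eq_card (B := mem E)) // => i; rewrite inE.
exists lam; split=> //; set G := \sum_j _; apply/eqP/negPn/negP => G_neq0.
pose d := (size G).-1.
have ltdp : (d < p)%N.
  rewrite /d prednK ?size_poly_gt0 //; apply: leq_trans (size_sum _ _ _) _.
  by apply/bigmax_leqP => j _; apply: leq_trans (size_scale_leq _ _) _.
have Gd : G`_d != 0 by rewrite -lead_coefE lead_coef_eq0.
have LG : \sum_n a n * iter n (derg ('X * g0)) G = 0.
  under eq_bigr do rewrite derg_sum mulr_sumr.
  rewrite exchange_big big1 //= => j _.
  under eq_bigr do rewrite -scalerAr.
  by rewrite -scaler_sumr LF scaler0.
have sG : (size G <= d.+1)%N by rewrite leqSpred.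
have qd : q.[d%:R] * G`_d = 0.
  have: (\sum_n a n * iter n (derg ('X * g0)) G)`_(e + d) = 0 by rewrite LG coef0.
  rewrite coef_sum => {2}<-; rewrite /q horner_sum mulr_suml.
  apply: eq_bigr => n _.
  have [sn cn] := iter_derg_top g0 n sG.
  have := coef_mul_top (sb n) sn; rewrite cn {1}/b mulrAC => cbn.
  move: cbn; rewrite [X in X = _ -> _]coefMXn addnA ltnNge leq_addl addnK /= => ->.
  rewrite hornerZ horner_prod -!mulrA; do 2![congr (_ * _)].
  by congr (_ * _); apply: eq_bigr => i _; rewrite !hornerE natrD.
have dE : Ordinal ltdp \in E.
  by move/eqP: qd; rewrite mulf_eq0 (negPf Gd) orbF inE.
have := lamE (exist (fun i => i \in E) _ dE); rewrite /= => Gd0; case/negP: Gd.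
rewrite /G coef_sum; apply/eqP; rewrite -[RHS]Gd0.
by apply: eq_bigr => j _; rewrite coefZ.
Qed.

(** As [g] does not vanish at y, each application of [derg] lowers the order at y by exactly one:
    the exponent that comes down is positive and less than p, hence nonzero in K. *)
Lemma iter_derg_XsubC (K : fieldType) (p v : nat) (g Q : {poly K}) (y : K) :
  p \in [pchar K] -> ~~ root g y -> ~~ root Q y -> (v < p)%N ->
  ~~ root (iter v (derg g) (('X - y%:P) ^+ v * Q)) y.
Proof.
move=> charK gy; elim: v Q => [|v IHv] Q Qy ltvp; first by rewrite expr0 mul1r.
rewrite iterSr; set Q1 := g * (v.+1%:R *: Q + ('X - y%:P) * Q^`()).
have -> : derg g (('X - y%:P) ^+ v.+1 * Q) = ('X - y%:P) ^+ v * Q1.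
  rewrite /derg derivM deriv_exp derivXsubC mul1r /Q1 /= -mulr_natl exprS.
  rewrite -mul_polyC polyC_natr; ring.
apply: IHv (ltnW ltvp); rewrite /Q1 rootM (negPf gy) /= rootE !hornerE subrr.
by rewrite mul0r addr0 !mulf_neq0 // (natr_pchar_neq0 charK).
Qed.

(** For nonzero [F], the size bound keeps its order v at y below p; if v < M, the v-th iterate of
    [derg] would not vanish at y. *)
Lemma dvd_XsubC_exp_derg (K : fieldType) (p M : nat) (g F : {poly K}) (y : K) :
  p \in [pchar K] -> ~~ root g y -> (size F <= p)%N ->
  (forall n, (n < M)%N -> root (iter n (derg g) F) y) ->
  ('X - y%:P) ^+ M %| F.
Proof.
move=> charK gy sF rootF.
have [v [Q Qy EF]] := multiplicity_XsubC F y.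
have [->|F_neq0] := eqVneq F 0; first exact: dvdp0.
rewrite F_neq0 /= in Qy.
have [leMv|ltvM] := leqP M v.
  by rewrite EF dvdp_mull // dvdp_exp2l.
have ltvp : (v < p)%N.
  apply: leq_trans sF; rewrite -(size_exp_XsubC v y); apply: dvdp_leq => //.
  by rewrite EF dvdp_mull.
have := rootF _ ltvM.
by rewrite EF mulrC (negPf (iter_derg_XsubC charK gy Qy ltvp)).
Qed.

(** * The Wronskian zero estimate *)

Lemma size_det_leS (K : fieldType) (r s : nat) (A : 'M[{poly K}]_r) :
  (forall i j, (size (A i j) <= s.+1)%N) -> (size (\det A) <= (r * s).+1)%N.
Proof.
move=> sA; apply: leq_trans (size_sum _ _ _) _; apply/bigmax_leqP => sg _.
rewrite size_Msign; apply: leq_trans (size_poly_prod_leq _ _) _.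
rewrite card_ord leq_subLR addnS ltnS -mulnS.
by rewrite -[X in (_ <= X * _)%N]card_ord -sum_nat_const leq_sum.
Qed.

Definition independent_upto (K : fieldType) (J : finType) (A : nat)
    (h : J -> {poly K}) :=
  forall P : J -> {poly K}, (forall j, (size (P j) <= A)%N) ->
    \sum_j P j * h j = 0 -> forall j, P j = 0.

(** Each application of [derg] raises degrees by at most deg g0 whatever [h] is, so the degree of
    [h] cancels in the quotient. *)
Lemma size_divp_derg (K : fieldType) (g0 h P : {poly K}) (n : nat) :
  h != 0 -> h %| 'X * g0 * h^`() ->
  (size (iter n (derg ('X * g0)%R) (P * h) %/ h)%R <= size P + n * (size g0).-1)%N.
Proof.
move=> h0 hh; have [->|P0] := eqVneq P 0.
  have -> : iter n (derg ('X * g0)) (0 * h) = 0.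
    by rewrite mul0r; elim: n => //= n ->; rewrite /derg deriv0 mulr0.
  by rewrite div0p size_poly0.
rewrite size_divp // leq_subLR; apply: leq_trans (size_iter_derg _ _ _) _.
have arith a b c : (0 < a -> 0 < b -> (a + b).-1 + c <= b.-1 + (a + c))%N by lia.
by rewrite size_mul //; apply: arith; rewrite size_poly_gt0.
Qed.

(* The matrix of the [D^n(P_j h_j) / h_j] sends the column of the [h_j] to the
   derivatives of [sum_j P_j h_j], so [(X - y)^T] divides its determinant, which
   has degree less than [T] and is nonzero by [derg_operator_kernel]. *)
Lemma zero_estimate (K : fieldType) (p A T : nat) (g0 : {poly K}) (y : K)
    (J : finType) (h P : J -> {poly K}) :
  p \in [pchar K] -> g0 != 0 -> root ('X * g0) y ->
  (forall j, h j %| 'X * g0 * (h j)^`()) -> (forall j, ~~ root (h j) y) ->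
  independent_upto A h ->
  (forall j, (size (P j) <= A)%N) -> (forall j, (size (P j * h j)%R <= p)%N) ->
  ('X - y%:P) ^+ T %| \sum_j P j * h j ->
  (#|J| * (A + #|J| * (size g0).-1) < T)%N ->
  forall j, P j = 0.
Proof.
move=> charK g0_neq0 gy hD hy indh sP sPh dvdT ltT j0.
apply/eqP/negPn/negP => Pj0.
(* Keeping only the nonzero [P j] ensures that a nontrivial relation between the products
   [P j * h j] is also one between the [h j]. *)
pose J1 := [set j | P j != 0]; pose r := #|J1|.
pose e (i : 'I_r) : J := enum_val i.
have j0J1 : j0 \in J1 by rewrite inE.
have Pe i : P (e i) != 0 by have := enum_valP i; rewrite inE.
have h_neq0 j : h j != 0 by apply: contraNneq (hy j) => ->; rewrite root0.
have lerJ : (r <= #|J|)%N by apply: max_card.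
pose F i := P (e i) * h (e i).
pose Q : 'M[{poly K}]_r :=
  \matrix_(n, i) (iter n (derg ('X * g0)) (F i) %/ h (e i)).
have QE n i : Q n i * h (e i) = iter n (derg ('X * g0)) (F i).
  by rewrite mxE divpK // dvd_iter_derg // dvdp_mull.
have sQ n i : (size (Q n i) <= (A + r * (size g0).-1).+1)%N.
  rewrite mxE; apply: leq_trans (size_divp_derg _ _ _ _) _ => //.
  by apply: leq_trans (leqnSn _); rewrite leq_add // leq_mul // ltnW.
clearbody Q.
have sumE (G : J -> {poly K}) : (forall j, j \notin J1 -> G j = 0) ->
    \sum_j G j = \sum_i G (e i).
  move=> G0; rewrite (bigID (mem J1)) /= [X in _ + X]big1 ?addr0 //.
  by rewrite big_enum_val.
have detQ : \det Q = 0.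
  apply/eqP/negPn/negP => detQ_neq0.
  (* Cramer's rule: the adjugate recovers [h j0], up to the determinant, from the derivatives of the
     sum. *)
  have detE : \det Q * h j0 = \sum_n \adj Q (enum_rank_in j0J1 j0) n *
      iter n (derg ('X * g0)) (\sum_i F i).
    have eJ : e (enum_rank_in j0J1 j0) = j0 by rewrite /e enum_rankK_in.
    set i0 := enum_rank_in _ _ in eJ *.
    have /matrixP/(_ i0 0) : \adj Q *m Q *m (\col_i h (e i)) =
        (\det Q)%:M *m (\col_i h (e i)) by rewrite mul_adj_mx.
    rewrite -mulmxA mul_scalar_mx !mxE eJ => <-.
    apply: eq_bigr => n _; congr (_ * _); rewrite !mxE.
    have := derg_sum ('X * g0) n (fun=> 1) F.
    under eq_bigr do rewrite scale1r; move=> ->.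
    by apply: eq_bigr => i _; rewrite scale1r -QE mxE.
  have : ('X - y%:P) ^+ T %| \det Q * h j0.
    rewrite detE; apply: (big_ind (fun G => ('X - y%:P) ^+ T %| G)) => [||n _].
    - exact: dvdp0.
    - exact: dvdp_add.
    apply: dvdp_mull; apply: dvd_iter_derg.
      (* Here ['X * g0] does vanish at y, so the multiples of (X - y)^T are stable under [derg]. *)
      rewrite deriv_exp derivXsubC mul1r; move: gy; rewrite -dvdp_XsubCl.
      case: (T) => [|T'] gy; first by rewrite mulr0n mulr0 dvdp0.
      by rewrite -mulr_natr mulrA dvdp_mulr //= exprS dvdp_mul.
    rewrite -(sumE (fun j => P j * h j)) // => j.
    by rewrite inE negbK => /eqP->; rewrite mul0r.
  rewrite mulrC Gauss_dvdpr; last first.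
    by apply: coprimep_expl; rewrite coprimep_sym coprimep_XsubC.
  move=> /(dvdp_leq detQ_neq0); rewrite size_exp_XsubC; apply/negP; rewrite -leqNgt.
  apply: leq_trans ltT; apply: leq_trans (size_det_leS sQ) _.
  by rewrite ltnS leq_mul // leq_add2l leq_mul2r lerJ orbT.
(* A nonzero row killed by [Q] is an operator of order less than r that annihilates every [F i]. *)
have /det0P[a /rV0Pn[n an] aQ] : \det Q == 0 by rewrite detQ.
have [|i|i|lam [[i lami] lamF]] := @derg_operator_kernel K p r g0 (a 0) F charK g0_neq0.
- by exists n.
- exact: sPh.
- have /matrixP/(_ 0 i) := aQ; rewrite !mxE => aQi.
  move: (congr1 (fun c => c * h (e i)) aQi); rewrite mul0r mulr_suml.
  by apply: etrans; apply: eq_bigr => m _; rewrite -mulrA QE.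
(* Extension of [lam] by zero; the match on [=P] yields the membership proof that [enum_rank_in]
   takes. *)
pose lam' j := if j \in J1 =P true is ReflectT jJ1 then lam (enum_rank_in jJ1 j) else 0.
have lamE i' : lam' (e i') = lam i'.
  rewrite /lam'; case: eqP => [eJ|]; last by rewrite enum_valP.
  by rewrite /e enum_valK_in.
have := indh (fun j => lam' j *: P j) _ _ (e i); rewrite lamE => /(_ _ _)/eqP.
rewrite scaler_eq0 (negPf lami) (negPf (Pe i)) /= => absurd; suff: false by [].
apply: absurd => [j|]; first exact: leq_trans (size_scale_leq _ _) _.
rewrite (sumE (fun j => lam' j *: P j * h j)) => [|j]; last first.
  by rewrite inE negbK => /eqP->; rewrite scaler0 mul0r.
by rewrite -[RHS]lamF; apply: eq_bigr => i' _; rewrite lamE scalerAl.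
Qed.

(** * Independence of the power products *)

(** The lowest surviving term [q ^+ c * Q c] is minus the sum of the later ones, all divisible by
    [q ^+ c.+1]; hence [q] divides [Q c]. *)
Lemma sum_exp_dvd_eq0 (K : fieldType) (B : nat) (q : {poly K})
    (Q : 'I_B -> {poly K}) :
  q != 0 -> \sum_(c < B) q ^+ c * Q c = 0 -> (forall c, q %| Q c -> Q c = 0) ->
  forall c : 'I_B, Q c = 0.
Proof.
move=> q_neq0 sumQ dvdQ.
suff IH n (c : 'I_B) : (c < n)%N -> Q c = 0 by move=> c; apply: (IH c.+1).
elim: n c => // n IHn c; rewrite ltnS leq_eqVlt => /orP[/eqP Ec|]; last exact: IHn.
apply: dvdQ; have qc_neq0 : q ^+ c != 0 by rewrite expf_neq0.
rewrite -(dvdp_mul2l _ _ qc_neq0) -exprSr.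
move: sumQ; rewrite (bigD1 c) //= => /eqP; rewrite addr_eq0 => /eqP ->.
rewrite dvdpNr; apply: (big_ind (fun G => q ^+ c.+1 %| G)) => [||i neq_ic].
- exact: dvdp0.
- exact: dvdp_add.
have [lt_ic|] := ltnP i c; first by rewrite IHn ?mulr0 ?dvdp0 // -Ec.
rewrite leq_eqVlt => /orP[/eqP eq_ci|lt_ci].
  by rewrite (val_inj eq_ci) eqxx in neq_ic.
by rewrite dvdp_mulr // dvdp_exp2l.
Qed.

Lemma dvd_mul_deriv (K : fieldType) (g h q : {poly K}) :
  h %| g * h^`() -> q %| g * q^`() -> h * q %| g * (h * q)^`().
Proof.
move=> hh qq; rewrite derivM mulrDr; apply: dvdp_add.
  by rewrite mulrA dvdp_mul.
by rewrite mulrCA dvdp_mul.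
Qed.

Lemma dvd_exp_deriv (K : fieldType) (g w : {poly K}) n :
  w %| g -> w ^+ n %| g * (w ^+ n)^`().
Proof.
move=> wg; elim: n => [|n IHn]; first by rewrite expr0 dvd1p.
by rewrite exprS dvd_mul_deriv // dvdp_mulr.
Qed.

(** Induction on n, the new index c being the exponent of [w n ^+ t]. At the chosen root of [w n] no
    earlier product vanishes, and the inequality in [B ^ i] is what [zero_estimate] needs for a
    family of [B ^ i] products. The bound by p keeps all [P j * h j] within its range. *)
Lemma power_product_family (K : fieldType) (p m A B t : nat) (g0 : {poly K})
    (w : nat -> {poly K}) (n : nat) :
  p \in [pchar K] -> g0 != 0 -> 'X * g0 = \prod_(i < m) w i ->
  (forall i, (i < m)%N ->
    exists y, root (w i) y /\ forall j, (j < i)%N -> ~~ root (w j) y) ->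
  (forall i, (i < m)%N -> (B ^ i * (A + B ^ i * (size g0).-1) < t)%N) ->
  (A + t * B * \sum_(i < m) (size (w i)).-1 <= p)%N ->
  (n <= m)%N ->
  exists (J : finType) (h : J -> {poly K}),
    [/\ #|J| = (B ^ n)%N /\ independent_upto A h,
        forall j, h j %| 'X * g0 * (h j)^`(),
        forall j, (size (h j) <= (t * B * \sum_(i < n) (size (w i)).-1).+1)%N,
        forall y, (forall i, (i < n)%N -> ~~ root (w i) y) ->
          forall j, ~~ root (h j) y &
        forall y, (forall i, (i < n)%N -> (w i).[y] ^+ t = 1) ->
          forall j, (h j).[y] = 1].
Proof.
move=> charK g0_neq0 gE wroot ltBt leAp; elim: n => [_|n IHn ltnm].
  exists unit, (fun=> 1); split.
  - rewrite card_unit; split=> // P sP.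
    by rewrite (bigD1 tt) //= big1 ?addr0 ?mulr1 => [P0 []|[]].
  - by move=> _; apply: dvd1p.
  - by move=> _; rewrite size_poly1.
  - by move=> y _ _; rewrite root1.
  - by move=> y _ _; rewrite hornerC.
have [J [h [[cardJ indh] hD sh hroot h1]]] := IHn (ltnW ltnm).
have wg : w n %| 'X * g0.
  by rewrite gE (bigD1 (Ordinal ltnm)) //= dvdp_mulr.
have g_neq0 : 'X * g0 != 0 by rewrite mulf_neq0 // polyX_eq0.
have w_neq0 : w n != 0 by apply: contraNneq g_neq0 => w0; rewrite w0 dvd0p in wg.
have [y [wy wjy]] := wroot n ltnm.
pose q := w n ^+ t.
have q_neq0 : q != 0 by rewrite expf_neq0.
exists (J * 'I_B)%type, (fun jc : J * 'I_B => h jc.1 * q ^+ jc.2); split.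
- split; first by rewrite card_prod cardJ card_ord expnSr.
  move=> P sP sumP.
  have Q0 : forall c : 'I_B, \sum_j P (j, c) * h j = 0.
    apply: (sum_exp_dvd_eq0 q_neq0) => [|c dvdq].
      rewrite -[RHS]sumP; under eq_bigr do rewrite mulr_sumr.
      rewrite exchange_big pair_big /=; apply: eq_bigr => -[j c] _ /=.
      by rewrite mulrCA [q ^+ _ * _]mulrC.
    have P0 : forall j, P (j, c) = 0.
      apply: (@zero_estimate K p A t g0 y J h) => //.
      + by rewrite -dvdp_XsubCl; apply: dvdp_trans wg; rewrite dvdp_XsubCl.
      + exact: hroot.
      + move=> j; apply: leq_trans leAp; apply: leq_trans (size_polyMleq _ _) _.
        rewrite -subn1 leq_subLR add1n -addnS leq_add // (leq_trans (sh j)) //.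
        rewrite ltnS leq_mul // -(subnKC (ltnW ltnm)) big_split_ord /=.
        by rewrite leq_addr.
      + by apply: dvdp_trans dvdq; rewrite dvdp_exp2r // dvdp_XsubCl.
      + by rewrite cardJ ltBt.
    by rewrite big1 // => j _; rewrite P0 mul0r.
  by case=> j c; apply: (indh (fun j => P (j, c))).
- by case=> j c /=; apply: dvd_mul_deriv => //; rewrite -exprM dvd_exp_deriv.
- case=> j c /=; rewrite big_ord_recr /= mulnDr; apply: size_mul_leS => //.
  rewrite -exprM (leq_trans (leqSpred _)) // ltnS size_exp mulnC leq_mul //.
  by rewrite leq_mul // ltnW.
- move=> z wz [j c] /=; rewrite rootM negb_or hroot => [|i /ltnW]; last exact: wz.
  by rewrite rootE !horner_exp !expf_eq0 -rootE (negPf (wz n _)) ?andbF.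
- move=> z wz [j c] /=; rewrite hornerM h1 => [|i /ltnW]; last exact: wz.
  by rewrite !horner_exp wz // expr1n mulr1.
Qed.

(** * Stepanov's method *)

Lemma dvd_prod_XsubC_exp (K : fieldType) (M : nat) (S : seq K) (F : {poly K}) :
  uniq S -> (forall y, y \in S -> ('X - y%:P) ^+ M %| F) ->
  (\prod_(y <- S) ('X - y%:P)) ^+ M %| F.
Proof.
elim: S => [|y S IHS] /=; first by rewrite big_nil expr1n dvd1p.
move=> /andP[yS uS] dvdF; rewrite big_cons exprMn Gauss_dvdp.
  rewrite dvdF ?mem_head // IHS // => z zS.
  by rewrite dvdF // in_cons zS orbT.
apply/coprimep_expl/coprimep_expr; rewrite coprimep_sym coprimep_XsubC.
by rewrite root_prod_XsubC.
Qed.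

(* [Psi = sum lam_(j,a) X^a h_j] with [h_j = 1] on [S]: the conditions imposed
   on [lam] make [D^n Psi] vanish on [S] for all [n < M]. *)
Lemma stepanov_bound (K : fieldType) (p m A B M t : nat) (g0 : {poly K})
    (w : nat -> {poly K}) (S : seq K) :
  p \in [pchar K] -> g0 != 0 -> 'X * g0 = \prod_(i < m) w i ->
  (forall i, (i < m)%N ->
    exists y, root (w i) y /\ forall j, (j < i)%N -> ~~ root (w j) y) ->
  (forall i, (i < m)%N -> (B ^ i * (A + B ^ i * (size g0).-1) < t)%N) ->
  (A + t * B * \sum_(i < m) (size (w i)).-1 <= p)%N ->
  (M * (A + M * (size g0).-1) < B ^ m * A)%N -> (0 < t)%N ->
  uniq S -> (forall y, y \in S -> forall i, (i < m)%N -> (w i).[y] ^+ t = 1) ->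
  (size S * M <= A + t * B * \sum_(i < m) (size (w i)).-1)%N.
Proof.
move=> charK g0_neq0 gE wroot ltBt leAp ltM t_gt0 uS wS.
have [J [h [[cardJ indh] hD sh _ h1]]] :=
  power_product_family charK g0_neq0 gE wroot ltBt leAp (leqnn m).
set D := (size g0).-1 in ltM; set g := 'X * g0 in gE hD.
set W := (\sum_(i < m) _)%N in leAp sh *.
have g_neq0 : g != 0 by rewrite mulf_neq0 // polyX_eq0.
have h_neq0 j : h j != 0.
  apply/eqP => h0; have A_gt0 : (0 < A)%N by case: (A) ltM => // /=; rewrite muln0.
  have := indh (fun i => (i == j)%:R) _ _ j; rewrite eqxx => /(_ _ _)/eqP.
  rewrite oner_eq0 => absurd; suff: false by []; apply: absurd => [i|].
    by case: (i == j); rewrite ?size_poly1 ?size_poly0.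
  by rewrite (bigD1 j) //= h0 mulr0 add0r big1 // => i /negPf->; rewrite mul0r.
pose R n (ja : J * 'I_A) := iter n (derg g) ('X^(ja.2) * h ja.1) %/ h ja.1.
have RE n ja : R n ja * h ja.1 = iter n (derg g) ('X^(ja.2) * h ja.1).
  by rewrite divpK // dvd_iter_derg // dvdp_mull.
have sR n ja : (n < M)%N -> (size (R n ja) <= A + M * D)%N.
  move=> ltnM; apply: leq_trans (size_divp_derg _ _ (h_neq0 _) (hD _)) _ => //.
  by rewrite size_polyXn leq_add // leq_mul // ltnW.
(* There are [B ^ m * A] unknowns. Making the combinations of the [R n] vanish identically for n < M
   costs [M * (A + M * D)] equations, a number independent of [S]. *)
have [|lam [[[j0 a0] lam0] lamR]] := @underdetermined_system K (J * 'I_A)%type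
    ('I_M * 'I_(A + M * D))%type (fun ja nl => (R nl.1 ja)`_nl.2).
  by rewrite !card_prod !card_ord cardJ.
have sumR n : (n < M)%N -> \sum_ja lam ja *: R n ja = 0.
  move=> ltnM; apply/polyP => l; rewrite coef0 coef_sum.
  have [ltl|lel] := ltnP l (A + M * D).
    rewrite -[RHS](lamR (Ordinal ltnM, Ordinal ltl)).
    by apply: eq_bigr => ja _; rewrite coefZ.
  rewrite big1 // => ja _; rewrite coefZ nth_default ?mulr0 //.
  by apply: leq_trans lel; apply: sR.
pose Psi := \sum_ja lam ja *: ('X^(ja.2) * h ja.1).
pose P j : {poly K} := \sum_(a < A) lam (j, a) *: 'X^a.
have Plam j (a : 'I_A) : (P j)`_a = lam (j, a).
  rewrite coef_sum (bigD1 a) //= coefZ coefXn eqxx mulr1 big1 ?addr0 // => b.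
  by rewrite -val_eqE /= coefZ coefXn eq_sym => /negPf->; rewrite mulr0.
have sP j : (size (P j) <= A)%N.
  apply: leq_trans (size_sum _ _ _) _; apply/bigmax_leqP => a _.
  by apply: leq_trans (size_scale_leq _ _) _; rewrite size_polyXn.
have PsiE : Psi = \sum_j P j * h j.
  under [RHS]eq_bigr do rewrite mulr_suml.
  rewrite pair_big /=; apply: eq_bigr => -[j a] _ /=.
  by rewrite scalerAl.
have Psi_neq0 : Psi != 0.
  apply/eqP; rewrite PsiE => /(indh _ sP)/(_ j0) P0.
  by move: lam0; rewrite -Plam P0 coef0 eqxx.
have sPsi : (size Psi <= (A + t * B * W))%N.
  rewrite PsiE; apply: leq_trans (size_sum _ _ _) _; apply/bigmax_leqP => j _.
  apply: leq_trans (size_polyMleq _ _) _.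
  by rewrite -subn1 leq_subLR add1n -addnS leq_add.
have dvdPsi : (\prod_(y <- S) ('X - y%:P)) ^+ M %| Psi.
  apply: dvd_prod_XsubC_exp => // y yS.
  apply: (dvd_XsubC_exp_derg (p := p) (g := g)) => //.
  (* On [S] each [w i] has t-th power 1 with t > 0, so [g] has no root there. *)
  - rewrite gE rootE horner_prod; apply/prodf_neq0 => i _.
    apply/eqP => wi0; have := wS y yS i (ltn_ord i).
    by rewrite wi0 expr0n gtn_eqF // => /eqP; rewrite eq_sym oner_eq0.
  - exact: leq_trans sPsi leAp.
  move=> n ltnM; rewrite rootE derg_sum horner_sum.
  have /(congr1 (horner^~ y)) := sumR n ltnM; rewrite horner0 horner_sum => sum0.
  apply/eqP; rewrite -[RHS]sum0; apply: eq_bigr => ja _.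
  by rewrite !hornerZ -RE hornerM (h1 y (wS y yS)) mulr1.
rewrite -ltnS; apply: leq_trans (leq_trans sPsi (leqnSn _)).
apply: leq_trans (dvdp_leq Psi_neq0 dvdPsi).
set V := \prod_(y <- S) _; rewrite -[size (V ^+ M)%R]prednK.
  by rewrite size_exp size_prod_XsubC.
by rewrite size_poly_gt0 expf_neq0 // monic_neq0 // monic_prod_XsubC.
Qed.

(** * Orbit sets and the group that they generate *)

Lemma orbit_setP (p k : nat) (f : 'I_k -> {poly 'F_p}) (u : 'F_p) (N : nat) x :
  reflect (exists2 s : seq 'I_k, (size s <= N)%N & x = word_eval f u s)
          (x \in orbit_set f u N).
Proof.
apply: (iffP bigcupP) => [[n _ /imsetP[s _ ->]]|[s les ->]].
  by exists s => //; rewrite size_tuple -ltnS.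
exists (Ordinal (les : (size s < N.+1)%N)) => //.
by apply/imsetP; exists (in_tuple s).
Qed.

Lemma orbit_set_iter (p k : nat) (f : 'I_k -> {poly 'F_p}) (u : 'F_p)
    (N n : nat) (i : 'I_k) x :
  x \in orbit_set f u N ->
  iter n (fun y => (f i).[y]) x \in orbit_set f u (N + n).
Proof.
move=> xN; elim: n => [|n /orbit_setP[s les Es]] /=; first by rewrite addn0.
by rewrite Es; apply/orbit_setP; exists (i :: s); rewrite //= addnS ltnS.
Qed.

Lemma orbit_setS (p k : nat) (f : 'I_k -> {poly 'F_p}) (u : 'F_p) (M N : nat) x :
  (M <= N)%N -> x \in orbit_set f u M -> x \in orbit_set f u N.
Proof.
move=> leMN /orbit_setP[s les ->]; apply/orbit_setP.
by exists s => //; apply: leq_trans leMN.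
Qed.

Lemma orbit_size_gt0 (p k : nat) (f : 'I_k -> {poly 'F_p}) (u : 'F_p) N :
  (0 < orbit_size f u N)%N.
Proof. by apply/card_gt0P; exists u; apply/orbit_setP; exists [::]. Qed.

(** A nonempty word is a letter applied to a shorter word; the extra point [u] is absorbed because
    the orbit set is nonempty. *)
Lemma orbit_sizeS (p k : nat) (f : 'I_k -> {poly 'F_p}) (u : 'F_p) N :
  (orbit_size f u N.+1 <= k.+1 * orbit_size f u N)%N.
Proof.
pose V := orbit_set f u N.
have sub : orbit_set f u N.+1 \subset
    ([set u] :|: [set (f ix.1).[ix.2] | ix in finset.setX [set: 'I_k] V])%SET.
  apply/fintype.subsetP => x /orbit_setP[[|i s] /= les ->]; rewrite !inE ?eqxx //.
  apply/orP; right; apply/imsetP; exists (i, word_eval f u s) => //.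
  by rewrite !inE /=; apply/orbit_setP; exists s.
apply: leq_trans (subset_leq_card sub) _; apply: leq_trans (leq_card_setU _ _) _.
rewrite cards1 mulSn leq_add ?orbit_size_gt0 //.
by apply: leq_trans (leq_imset_card _ _) _; rewrite cardsX cardsT card_ord.
Qed.

(** Leaving room for m further iterations costs only a constant factor. *)
Lemma orbit_size_sub (p k : nat) (f : 'I_k -> {poly 'F_p}) (u : 'F_p) N m :
  (orbit_size f u N <= k.+1 ^ m * orbit_size f u (N - m))%N.
Proof.
elim: m => [|m IHm]; first by rewrite subn0 mul1n.
apply: leq_trans IHm _; rewrite expnSr -mulnA leq_mul2l; apply/orP; right.
rewrite subnS; case: (N - m)%N => [|n]; last exact: orbit_sizeS.
by rewrite leq_pmull.
Qed.

Lemma orbit_unit (p k : nat) (f : 'I_k -> {poly 'F_p}) (u : 'F_p) N x :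
  prime p -> x \in orbit_set f u N -> x != 0 ->
  exists2 g : {unit 'F_p}, g \in orbit_group f u N & val g = x.
Proof.
move=> pr_p xN x_neq0; have ux : x \is a GRing.unit by rewrite unitfE.
by exists (Sub x ux); rewrite ?SubK // mem_gen // inE SubK.
Qed.

(** Lagrange's theorem turns membership in the group into an equation. *)
Lemma orbit_expr1 (p k : nat) (f : 'I_k -> {poly 'F_p}) (u : 'F_p) N x :
  prime p -> x \in orbit_set f u N -> x != 0 ->
  x ^+ orbit_group_size f u N = 1.
Proof.
move=> pr_p xN /(orbit_unit pr_p xN)[g gG <-].
rewrite /orbit_group_size; move: gG; rewrite /orbit_group.
set A := finset _; move=> /order_dvdG; rewrite order_dvdn => /eqP gA.
by rewrite -FinRing.val_unitX gA FinRing.val_unit1.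
Qed.

Lemma orbit_size_le_group (p k : nat) (f : 'I_k -> {poly 'F_p}) (u : 'F_p) N :
  prime p -> (orbit_size f u N <= (orbit_group_size f u N).+1)%N.
Proof.
move=> pr_p; pose G := [set val g | g in orbit_group f u N]%SET.
have sub : orbit_set f u N \subset (0 |: G)%SET.
  apply/fintype.subsetP => x xN; rewrite !inE; have [//|x_neq0] := eqVneq x 0.
  have [g gG <-] := orbit_unit pr_p xN x_neq0.
  by apply/imsetP; exists g.
apply: leq_trans (subset_leq_card sub) _; apply: leq_trans (leq_card_setU _ _) _.
by rewrite cards1 add1n ltnS leq_imset_card.
Qed.

(** * Iterates of one polynomial and cycles through 0 *)

Definition iter_poly (R : nzRingType) (f : {poly R}) n :=
  iter n (fun q => f \Po q) 'X.

Lemma horner_iter_poly (R : comNzRingType) (f : {poly R}) n x :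
  (iter_poly f n).[x] = iter n (fun y => f.[y]) x.
Proof.
elim: n => [|n IHn] /=; first by rewrite hornerX.
by rewrite horner_comp [in LHS]IHn.
Qed.

Lemma size_iter_poly (R : idomainType) (f : {poly R}) n :
  (size (iter_poly f n)).-1 = ((size f).-1 ^ n)%N.
Proof.
elim: n => [|n IHn] /=; first by rewrite size_polyX.
by rewrite size_comp_poly [X in (_ * X)%N]IHn expnS.
Qed.

Lemma map_iter_poly (R S : comNzRingType) (iota : {rmorphism R -> S})
    (f : {poly R}) n :
  map_poly iota (iter_poly f n) = iter_poly (map_poly iota f) n.
Proof.
elim: n => [|n IHn] /=; first by rewrite map_polyX.
by rewrite map_comp_poly [in LHS]IHn.
Qed.

(** Up to its least return time, the orbit of 0 under polynomial i traces a cycle whose edges all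
    carry the label i, of length below m. *)
Lemma iter_zero_neq0 (F : nzRingType) (K : closedFieldType)
    (iota : {rmorphism F -> K}) (k m : nat) (f : 'I_k -> {poly F}) (i : 'I_k)
    (R : realType) (n : nat) :
  ((m%:R)%:E <= shortest_cycle_at iota f R 0)%E -> (0 < n < m)%N ->
  iter n (fun y => (map_poly iota (f i)).[y]) 0 != 0.
Proof.
move=> lem /andP[n_gt0 ltnm]; set phi := fun y => _; apply/negP => iter_n0.
have exn : exists n, (0 < n)%N && (iter n phi 0 == 0) by exists n; rewrite n_gt0.
have [n1 /andP[n1_gt0 /eqP iter_n1] min_n1] := ex_minnP exn.
have le_n1 : (n1 <= n)%N by rewrite min_n1 // n_gt0.
have inj_v : injective (fun j : 'I_n1 => iter j phi 0).
  suff wlog_lt (j l : 'I_n1) : (j < l)%N -> iter j phi 0 != iter l phi 0.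
    move=> j l eq_jl; apply/val_inj.
    by have [/wlog_lt|/wlog_lt|//] := ltngtP (val j) (val l); rewrite eq_jl eqxx.
  (* Equal iterates at j < l would bring 0 back after [n1 - l + j] steps, too early. *)
  move=> lt_jl; apply/eqP => eq_jl; have := min_n1 (n1 - l + j)%N.
  rewrite addn_gt0 subn_gt0 ltn_ord /= iterD eq_jl -iterD.
  rewrite subnK ?iter_n1 ?eqxx //; last exact: ltnW.
  by move=> /(_ isT); have := ltn_ord l; lia.
suff cyc : cycle_length_at iota f 0 n1.
  have : (shortest_cycle_at iota f R 0 <= (n1%:R)%:E)%E.
    by apply: ereal_inf_lbound; exists n1.
  move=> /(le_trans lem); rewrite lee_fin ler_nat; lia.
exists (fun j => iter j phi 0), (fun j => (iter j phi 0, i)); split; last first.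
  by exists (Ordinal n1_gt0).
split=> // [j l [] /inj_v //|j]; left; split=> //=.
rewrite /edge_target /= -iterS; have := ltn_ord j.
rewrite leq_eqVlt => /orP[/eqP En1|ltj].
  by rewrite En1 modnn iter_n1.
by rewrite modn_small.
Qed.

Lemma size_prod_ord (R : idomainType) (m : nat) (F : nat -> {poly R}) :
  (forall i, (i < m)%N -> F i != 0) ->
  size (\prod_(i < m) F i) = (\sum_(i < m) (size (F i)).-1).+1.
Proof.
elim: m => [|m IHm] F_neq0; first by rewrite !big_ord0 size_poly1.
have Fm := F_neq0 m (ltnSn m).
have F_neq0' i : (i < m)%N -> F i != 0 by move=> ltim; apply/F_neq0/ltnW.
rewrite !big_ord_recr /= size_mul ?IHm //; last first.
  by apply/prodf_neq0 => i _; apply: F_neq0'.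
by rewrite -[X in (_.+1 + X)%N]prednK ?size_poly_gt0 // addSn addnS.
Qed.

Lemma iter_poly_neq0 (R : idomainType) (f : {poly R}) (n : nat) :
  (0 < (size f).-1)%N -> iter_poly f n != 0.
Proof.
move=> f_gt0; have : (0 < (size (iter_poly f n)).-1)%N.
  by rewrite size_iter_poly expn_gt0 f_gt0.
by apply: contraTneq => ->; rewrite size_poly0.
Qed.

Lemma sum_size_iter_poly (R : idomainType) (f : {poly R}) (m d : nat) :
  (0 < (size f).-1 <= d)%N ->
  (\sum_(i < m) (size (iter_poly f i)).-1 <= m * d ^ m)%N.
Proof.
move=> /andP[f_gt0 f_led]; rewrite -[X in (_ <= X * _)%N]card_ord -sum_nat_const.
apply: leq_sum => i _; rewrite size_iter_poly.
apply: (@leq_trans (d ^ i)%N); first by case: (val i) => // j; rewrite leq_exp2r.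
by rewrite leq_pexp2l ?(ltnW (ltn_ord i)) // (leq_trans f_gt0).
Qed.

Lemma card_iter_zero (F : finFieldType) (f : {poly F}) (m d : nat) :
  (0 < (size f).-1 <= d)%N ->
  (#|[set x : F | [exists i : 'I_m, iter i (fun y => f.[y]) x == 0%R]]%SET|
     <= m * d ^ m)%N.
Proof.
move=> degf; have /andP[f_gt0 _] := degf; set Z := finset _.
have w_neq0 i : iter_poly f i != 0 by apply: iter_poly_neq0.
have prod_neq0 : \prod_(i < m) iter_poly f i != 0 by apply/prodf_neq0.
have : all (root (\prod_(i < m) iter_poly f i)) (enum Z).
  apply/allP => x; rewrite mem_enum inE => /existsP[i /eqP xi].
  by rewrite rootE (bigD1 i) //= hornerM horner_iter_poly xi mul0r.
move=> /(max_poly_roots prod_neq0)/(_ (enum_uniq _)).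
rewrite size_prod_ord // ltnS -cardE => leZ.
exact: leq_trans leZ (sum_size_iter_poly _ degf).
Qed.

(** * Choice of the parameters and the resulting bounds *)

(** The constant [4 ^ m] comes from [B.+1 <= 2 * B]. Division by [B ^ m.-1] leaves B^(2m+1-(m-1)) =
    B^(m+2), of order t^(1/2+1/m). *)
Lemma arith_stepanov (E B m t s : nat) :
  (0 < E)%N -> (0 < B)%N -> (0 < m)%N ->
  (t < 2 * E * B.+1 ^ (2 * m))%N ->
  (s * B ^ m.-1 <= B ^ m.-1 * E + t * B * E)%N ->
  (s <= (E + 2 * E * E * 4 ^ m) * B ^ (m + 2))%N.
Proof.
move=> E_gt0 B_gt0 m_gt0 ltt les.
have Bm_gt0 : (0 < B ^ m.-1)%N by rewrite expn_gt0 B_gt0.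
have letB : (t <= 2 * E * (4 ^ m * B ^ (2 * m)))%N.
  apply: leq_trans (ltnW ltt) _; rewrite leq_mul2l; apply/orP; right.
  rewrite -[4%N]/(2 ^ 2)%N -expnM -expnMn leq_exp2r; last by rewrite muln_gt0.
  by lia.
rewrite -(leq_pmul2r Bm_gt0); apply: leq_trans les _.
rewrite -[X in (_ <= X)%N]mulnA -expnD; have -> : (m + 2 + m.-1 = (2 * m).+1)%N by lia.
rewrite mulnDl leq_add //.
  rewrite mulnC leq_mul2l; apply/orP; right; rewrite leq_pexp2l //; lia.
rewrite expnS; apply: leq_trans (_ : 2 * E * (4 ^ m * B ^ (2 * m)) * B * E <= _)%N.
  by rewrite !leq_mul.
by apply/eq_leq; ring.
Qed.

Lemma orbit_size0 (p k : nat) (f : 'I_k -> {poly 'F_p}) (u : 'F_p) :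
  orbit_size f u 0 = 1%N.
Proof.
rewrite -(cards1 u); congr #|pred_of_set _|; apply/setP => x; rewrite inE.
apply/orbit_setP/eqP => [[s]|->]; last by exists [::].
by rewrite leqn0 size_eq0 => /eqP->.
Qed.

(** Here [E] bounds both the total degree of the first m iterates and the number of points where one
    of them vanishes. These points are discarded, and [stepanov_bound] counts the others in the
    orbit up to [N - m]. *)
Lemma orbit_size_bound (R : realType) (p k d m : nat) (K : closedFieldType)
    (iota : {rmorphism 'F_p -> K}) (f : 'I_k -> {poly 'F_p}) (i0 : 'I_k)
    (u : 'F_p) (N B : nat) :
  let E := (m * d ^ m)%N in let t := orbit_group_size f u N in
  prime p -> (1 < m)%N -> (0 < (size (f i0)).-1 <= d)%N ->
  ((m%:R)%:E <= shortest_cycle_at iota f R 0)%E ->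
  (2 < B)%N -> (2 * E * B ^ (2 * m) <= t)%N -> (t < 2 * E * B.+1 ^ (2 * m))%N ->
  (2 * E * (t * B) <= p)%N ->
  (orbit_size f u N <=
     k.+1 ^ m * (1 + 2 * E + 2 * E * E * 4 ^ m) * B ^ (m + 2))%N.
Proof.
move=> E t pr_p m_gt1 degf cyc B_gt2 let_t lt_t le_p.
have m_gt0 : (0 < m)%N := ltnW m_gt1.
have B_gt0 : (0 < B)%N := ltnW (ltnW B_gt2).
have /andP[f_gt0 f_led] := degf.
have E_gt0 : (0 < E)%N by rewrite muln_gt0 m_gt0 expn_gt0 (leq_trans f_gt0).
pose phi x := (f i0).[x].
pose Z := [set x : 'F_p | [exists i : 'I_m, iter i phi x == 0%R]]%SET.
have leZ : (#|Z| <= E)%N by apply: card_iter_zero.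
have sum_E : (\sum_(i < m) (size (iter_poly (f i0) i)).-1 <= E)%N.
  exact: sum_size_iter_poly.
have expr_t x : x \in orbit_set f u N -> x != 0 -> x ^+ t = 1.
  exact: orbit_expr1.
clearbody E t.
have t_gt0 : (0 < t)%N.
  by apply: leq_trans let_t; rewrite !muln_gt0 E_gt0 expn_gt0 B_gt0.
pose w i := map_poly iota (iter_poly (f i0) i).
have wE i x : (w i).[iota x] = iota (iter i phi x).
  by rewrite /w horner_map horner_iter_poly.
have sw i : size (w i) = size (iter_poly (f i0) i) by rewrite size_map_poly.
have w_neq0 i : w i != 0 by rewrite map_poly_eq0 iter_poly_neq0.
have sum_w : (\sum_(i < m) (size (w i)).-1 <= E)%N.
  by under eq_bigr do rewrite sw.
pose g0 := \prod_(i < m.-1) w i.+1.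
have g0_neq0 : g0 != 0 by apply/prodf_neq0.
have gE : 'X * g0 = \prod_(i < m) w i.
  by rewrite -(prednK m_gt0) big_ord_recl /w /= map_polyX.
have size_g0 : ((size g0).-1 <= E)%N.
  have := size_prod_ord (fun i (_ : (i < m)%N) => w_neq0 i).
  rewrite -gE mulrC size_mulX // => -[sg0].
  by apply: leq_trans (leq_pred _) _; rewrite sg0.
have charK : p \in [pchar K] by apply: (rmorph_pchar iota); apply: pchar_Fp.
have wroot i : (i < m)%N ->
    exists y, root (w i) y /\ forall j, (j < i)%N -> ~~ root (w j) y.
  move=> ltim; have /closed_rootP[y wy] : size (w i) != 1%N.
    rewrite sw -[size _]prednK ?size_poly_gt0 ?iter_poly_neq0 //.
    by rewrite size_iter_poly -lt0n // expn_gt0 f_gt0.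
  (* At a common root y, [w j] sends y to 0, so i - j further steps would lead from 0 back to 0. *)
  exists y; split=> // j lt_ji; apply/negP => wjy.
  have lt_ijm : (0 < i - j < m)%N.
    by rewrite subn_gt0 lt_ji (leq_ltn_trans (leq_subr _ _)).
  have /negP[] := iter_zero_neq0 i0 cyc lt_ijm.
  move: wy wjy; rewrite !rootE /w !map_iter_poly !horner_iter_poly => wy /eqP wjy.
  by rewrite -[X in iter _ _ X]wjy -iterD subnK // ltnW.
(* With this [A] one has [A + M * E = 2 * M * E]. The conditions of [stepanov_bound] then follow
   from 2 < B, from 2 E M^2 < t and from 2 E t B <= p. *)
pose M := (B ^ m.-1)%N; pose A := (M * E)%N.
have BmE : (B ^ m = M * B)%N by rewrite -expnSr prednK.
have M_gt0 : (0 < M)%N by rewrite expn_gt0 B_gt0.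
have MM_lt : (2 * E * (M * M) < t)%N.
  apply: leq_trans let_t; rewrite ltn_pmul2l ?muln_gt0 ?E_gt0 //.
  by rewrite -expnD ltn_exp2l //; lia.
have leAt : (A <= t)%N.
  apply: leq_trans (ltnW MM_lt); rewrite /A; nia.
pose V := orbit_set f u (N - m).
pose S0 := (V :\: Z)%SET.
pose S := [seq iota x | x <- enum S0].
have leS : (m <= N)%N -> (size S * M <= A + t * B * E)%N.
  move=> lemN.
  apply: (@leq_trans (A + t * B * \sum_(i < m) (size (w i)).-1)%N); last first.
    by rewrite leq_add2l leq_mul2l sum_w orbT.
  apply: (@stepanov_bound K p m A B M t g0 w S) => //.
  - move=> i ltim; have leBi : (B ^ i <= M)%N by rewrite leq_pexp2l //; lia.
    apply: leq_ltn_trans MM_lt.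
    apply: (@leq_trans (M * (A + M * E))); last by rewrite /A; nia.
    by rewrite leq_mul // leq_add2l leq_mul.
  - apply: leq_trans le_p; apply: (@leq_trans (A + t * B * E)%N).
      by rewrite leq_add2l leq_mul2l sum_w orbT.
    nia.
  - apply: (@leq_ltn_trans (M * (A + M * E))).
      by rewrite leq_mul2l leq_add2l leq_mul2l size_g0 !orbT.
    rewrite BmE -mulnA ltn_pmul2l // /A; nia.
  - by rewrite map_inj_uniq ?enum_uniq //; apply: fmorph_inj.
  move=> _ /mapP[x + ->] i ltim; rewrite mem_enum !inE negb_exists.
  move=> /andP[/forallP xZ xV].
  rewrite wE -rmorphXn expr_t ?rmorph1 //; last exact: (xZ (Ordinal ltim)).
  apply: (@orbit_setS _ _ _ _ (N - m + i)); last exact: orbit_set_iter.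
  by lia.
apply: leq_trans (orbit_size_sub _ _ _ m) _; rewrite -mulnA leq_mul2l; apply/orP; right.
have Bm2_gt0 : (0 < B ^ (m + 2))%N by rewrite expn_gt0 B_gt0.
(* For N < m truncated subtraction leaves the orbit set of the empty word, of size 1. *)
have [ltNm|lemN] := ltnP N m.
  have -> : (N - m = 0)%N by lia.
  by rewrite orbit_size0 muln_gt0 Bm2_gt0 andbT.
have := arith_stepanov E_gt0 B_gt0 m_gt0 lt_t (leS lemN).
rewrite size_map -cardE => leS0.
have : (orbit_size f u (N - m) <= E + #|S0|)%N.
  rewrite /orbit_size -(cardsID Z) leq_add2r.
  by rewrite (leq_trans _ leZ) // subset_leq_card // subsetIr.
move=> /leq_trans; apply; apply: leq_trans (leq_add (leqnn E) leS0) _.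
rewrite !mulnDl !mul0n !mul1n.
by have := leq_pmulr E Bm2_gt0; lia.
Qed.

(** Take for [B] the integer part of the n-th root of t / a. *)
Lemma power_bracket (a n t : nat) :
  (0 < a)%N -> (0 < n)%N -> (a * 3 ^ n <= t)%N ->
  exists B : nat, [/\ (2 < B)%N, (a * B ^ n <= t)%N & (t < a * B.+1 ^ n)%N].
Proof.
move=> a_gt0 n_gt0 le3.
have ex3 : exists B, (2 < B)%N && (a * B ^ n <= t)%N by exists 3%N.
have bound B : (2 < B)%N && (a * B ^ n <= t)%N -> (B <= t)%N.
  move=> /andP[_]; apply: leq_trans; apply: leq_trans (leq_pmull _ a_gt0).
  case: n n_gt0 {le3 ex3} => // n _; case: B => // B.
  by rewrite expnS leq_pmulr // expn_gt0.
have [B /andP[B_gt2 leB] maxB] := ex_maxnP ex3 bound.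
exists B; split=> //; rewrite ltnNge; apply/negP => leB1.
have := maxB B.+1; by rewrite leB1 andbT ltnn => /(_ (ltnW B_gt2)).
Qed.

(** The exponent (m + 2)(2 - eps) is at most 2m because m eps >= 4. *)
Lemma powR_orbit_bound (R : realType) (eps : R) (m V C B t : nat) :
  0 < eps -> eps < 1 -> 4 <= m%:R * eps ->
  (0 < B)%N -> (0 < C)%N -> (V <= C * B ^ (m + 2))%N -> (B ^ (2 * m) <= t)%N ->
  V%:R `^ (2 - eps) <= C%:R ^+ 2 * t%:R :> R.
Proof.
move=> eps_gt0 eps_lt1 m_eps B_gt0 C_gt0 leV leBt.
have B_ge1 : 1 <= B%:R :> R by rewrite ler1n.
have C_ge1 : 1 <= C%:R :> R by rewrite ler1n.
apply: (@le_trans _ _ ((C%:R * B%:R ^+ (m + 2)) `^ (2 - eps))).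
  have e_ge0 : 0 <= 2 - eps by lra.
  by apply: (ge0_ler_powR e_ge0); rewrite ?nnegrE -?natrX -?natrM ?ler0n ?ler_nat.
rewrite powRM ?exprn_ge0 ?ler0n //; apply: ler_pM; rewrite ?powR_ge0 //.
  by rewrite -powR_mulrn ?ler0n //; apply: ler_powR => //; lra.
apply: (@le_trans _ _ (B%:R ^+ (2 * m))); last by rewrite -natrX ler_nat.
rewrite -!powR_mulrn ?ler0n // -powRrM; apply: ler_powR => //.
by rewrite natrD natrM; lra.
Qed.

(** The factor B^(1 - eps) is absorbed by t^eps, which is at least B^(2 m eps) with 2 m eps >= 8. *)
Lemma powR_char_bound (R : realType) (eps : R) (m p C B t : nat) :
  0 < eps -> eps < 1 -> 4 <= m%:R * eps ->
  (0 < B)%N -> (0 < C)%N -> (p <= C * (t * B))%N -> (B ^ (2 * m) <= t)%N ->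
  p%:R `^ (1 - eps) <= C%:R * t%:R :> R.
Proof.
move=> eps_gt0 eps_lt1 m_eps B_gt0 C_gt0 lep leBt.
have t_gt0 : (0 < t)%N by apply: leq_trans leBt; rewrite expn_gt0 B_gt0.
have B_ge1 : 1 <= B%:R :> R by rewrite ler1n.
have C_ge1 : 1 <= C%:R :> R by rewrite ler1n.
have t_neq0 : t%:R != 0 :> R by rewrite pnatr_eq0 -lt0n.
apply: (@le_trans _ _ ((C%:R * (t%:R * B%:R)) `^ (1 - eps))).
  have e_ge0 : 0 <= 1 - eps by lra.
  by apply: (ge0_ler_powR e_ge0); rewrite ?nnegrE -?natrM ?ler0n ?ler_nat.
rewrite !powRM ?mulr_ge0 ?ler0n //; apply: ler_pM; rewrite ?mulr_ge0 ?powR_ge0 //.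
  by rewrite -[leRHS]powRr1 ?ler0n //; apply: ler_powR => //; lra.
have tE : t%:R `^ (1 - eps) * t%:R `^ eps = t%:R :> R.
  by rewrite -powRD ?subrK ?powRr1 ?ler0n // t_neq0 implybT.
rewrite -[leRHS]tE ler_wpM2l ?powR_ge0 //.
apply: (@le_trans _ _ ((B%:R ^+ (2 * m)) `^ eps)).
  rewrite -powR_mulrn ?ler0n // -powRrM; apply: ler_powR => //.
  by rewrite natrM; lra.
by apply: (ge0_ler_powR (ltW eps_gt0)); rewrite ?nnegrE -?natrX ?ler0n ?ler_nat.
Qed.

Theorem theorem1p1 (R : realType) (eps : R) (k d : nat)
    (eps_gt0 : 0 < eps) (k_ge1 : (1 <= k)%N) (d_ge2 : (2 <= d)%N) :
  exists c1 c2 : R, [/\ 0 < c1, 0 < c2 &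
    forall (p : nat) (p_prime : prime p)
           (K : closedFieldType) (iota : {rmorphism 'F_p -> K})
           (K_algebraic : integralRange iota)
           (f : 'I_k -> {poly 'F_p}),
      (forall i : 'I_k, (1 <= (size (f i)).-1 <= d)%N) ->
      (c1%:E <= shortest_cycle_at iota f R 0)%E ->
      forall (u : 'F_p) (N : nat), (1 <= N)%N ->
        c2 * Num.min ((orbit_size f u N)%:R `^ (2 - eps)) (p%:R `^ (1 - eps))
          <= (orbit_group_size f u N)%:R].
Proof.
(* The loss t^(1/m) is harmless once m eps >= 4; the two successors give m > 1. *)
pose m := (Num.bound (4 / eps)).+2.
have m_eps : 4 <= m%:R * eps.
  rewrite -ler_pdivrMr //; apply: (@le_trans _ _ (Num.bound (4 / eps))%:R).
    by rewrite ltW // archi_boundP // divr_ge0 // ltW.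
  by rewrite ler_nat; lia.
pose E := (m * d ^ m)%N.
(* The first summand is the constant of [orbit_size_bound]; the second covers the t too small to
   admit some B >= 3 and dominates [2 * E]. *)
pose C := (k.+1 ^ m * (1 + 2 * E + 2 * E * E * 4 ^ m) + 2 * E * 3 ^ (2 * m))%N.
have m_gt1 : (1 < m)%N by [].
have E_gt0 : (0 < E)%N by rewrite muln_gt0 expn_gt0 (ltnW d_ge2).
have E3_gt0 : (0 < 3 ^ (2 * m))%N by rewrite expn_gt0.
have leEC : (2 * E <= C)%N.
  by apply: leq_trans (leq_addl _ _); rewrite leq_pmulr.
have C_gt0 : (0 < C)%N by apply: leq_trans leEC; rewrite muln_gt0.
clearbody m.
exists m%:R, (C%:R ^+ 2)^-1; split.
- by rewrite ltr0n ltnW.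
- by rewrite invr_gt0 exprn_gt0 // ltr0n.
move=> p p_prime K iota _ f degf cyc u N _.
set V := orbit_size f u N; set t := orbit_group_size f u N.
have C_ge1 : 1 <= C%:R :> R by rewrite ler1n.
have C2_gt0 : 0 < C%:R ^+ 2 :> R by rewrite exprn_gt0 // ltr0n.
have t_gt0 : (0 < t)%N by apply: cardG_gt0.
have V_le : (V <= t.+1)%N by apply: orbit_size_le_group.
rewrite ler_pdivrMl // ge_min.
(* For eps >= 1 the power of p is at most 1. *)
have [eps_lt1|eps_ge1] := ltP eps 1; last first.
  apply/orP; right; apply: (@le_trans _ _ 1).
    rewrite -[leRHS](powRr0 p%:R); apply: ler_powR; last by lra.
    by rewrite ler1n prime_gt0.
  by rewrite -natrX -natrM ler1n muln_gt0 expn_gt0 C_gt0.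
(* For small t the trivial bound V <= t + 1 is a constant, and [B := 1] serves. *)
have [lt_t|le_t] := ltnP t (2 * E * 3 ^ (2 * m)).
  apply/orP; left; apply: (powR_orbit_bound (m := m) (B := 1)) => //.
    rewrite exp1n muln1; apply: leq_trans V_le _; apply: leq_trans lt_t _.
    exact: leq_addl.
  by rewrite exp1n.
have [||B [B_gt2 let_t lt_t]] := @power_bracket (2 * E) (2 * m) t _ _ le_t.
- by rewrite muln_gt0.
- by rewrite muln_gt0 (ltnW m_gt1).
have B_gt0 : (0 < B)%N := ltnW (ltnW B_gt2).
have leBt : (B ^ (2 * m) <= t)%N.
  by apply: leq_trans let_t; rewrite leq_pmull // muln_gt0.
(* If 2 E t B exceeds p, the degree condition of Stepanov's method may fail, but then t is already
   close to p. *)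
have [le_p|lt_p] := leqP (2 * E * (t * B)) p.
  apply/orP; left; apply: (powR_orbit_bound (m := m) _ _ _ B_gt0) => //.
  have := orbit_size_bound p_prime m_gt1 (degf (Ordinal k_ge1)) cyc
    B_gt2 let_t lt_t le_p.
  by move=> leV; apply: leq_trans leV _; rewrite leq_mul2r leq_addr orbT.
apply/orP; right; apply: (@le_trans _ _ (C%:R * t%:R)).
  apply: (powR_char_bound (m := m) _ _ _ B_gt0) => //; apply: leq_trans (ltnW lt_p) _.
  by rewrite leq_mul2r leEC orbT.
by rewrite ler_pM2r ?ltr0n // expr2 ler_peMl // ler0n.
Qed.
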